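(* Let $F:\mathbb{R}^n\to\mathbb{R}$ be a convex $C^2$ function having a unique minimizer $x^*$; let $F^*=F(x^* )$. Assume that $F$ satisfies $\mathcal{H}_{\gamma_1}$ and $\mathcal{G}_\mu^{\gamma_2}$ for some $\gamma_1>2$, $\gamma_2>2$ such that $\gamma_1\geq\gamma_2$, and some $\mu>0$. Let $x$ be a solution of (DIN-AVD) for all $t\geq t_0$, where $t_0>0$, $\alpha\geq\frac{\gamma_1+2}{\gamma_1-2}$ and $\beta>0$. Then, as $t\to+\infty$, $$F(x(t))-F^*=\mathcal{O}\left(t^{-\frac{2\gamma_1}{\gamma_1-2}}\right).$$ Moreover, $$\int_{t_0}^{+\infty}u^{\frac{2\gamma_1}{\gamma_1-2}}\|\nabla F(x(u))\|^2\,du<+\infty.$$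
   Context: $\mathbb{R}^n$ carries the Euclidean inner product $\langle\cdot,\cdot\rangle$ and norm $\|\cdot\|$; $d(x,X)=\inf_{y\in X}\|x-y\|$. $H_F$ denotes the Hessian of $F$. (DIN-AVD) is the ODE $$\ddot x(t)+\frac{\alpha}{t}\dot x(t)+\beta H_F(x(t))\dot x(t)+\nabla F(x(t))=0,\qquad t\geq t_0,$$ with $t_0>0$ and initial conditions $x(t_0)\in\mathbb{R}^n$, $\dot x(t_0)=0$. For a convex differentiable $F:\mathbb{R}^n\to\mathbb{R}$ with nonempty set of minimizers $X^*$ and $F^*=\min F$: - $F$ satisfies $\mathcal{G}_\mu^\gamma$ ($\gamma\geq1$, $\mu>0$) if $\frac{\mu}{2}d(x,X^* )^\gamma\leq F(x)-F^*$ for all $x\in\mathbb{R}^n$. - $F$ satisfies $\mathcal{H}_\gamma$ ($\gamma\geq 1$) if for all $x^*\in X^*$ and all $x\in\mathbb{R}^n$, $F(x)-F^*\leq\frac1\gamma\langle\nabla F(x),x-x^*\rangle$. *)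

(* Defs.v *)
From mathcomp Require Import all_boot all_order all_algebra.
From mathcomp Require Import all_classical all_reals all_analysis.
Import Order.TTheory GRing.Theory Num.Theory.
Import numFieldNormedType.Exports.

Set Implicit Arguments.
Unset Strict Implicit.
Unset Printing Implicit Defensive.

Local Open Scope classical_set_scope.
Local Open Scope ring_scope.

(* The library has no canonical filter structure on the filter +oo of R; the
   Landau notation f =O_F g needs one. *)
Canonical pinfty_filter_on (R : realType) : filter_on R :=
  FilterType (pinfty_nbhs R) _.

(* R^n is the type of row vectors 'rV[R]_n.  The library norm `|x| on it is the
   sup norm: it is only used through the topology and the differential calculus
   it induces, which do not depend on the choice of norm.  Everything metric is
   stated with the Euclidean structure below. *)

Section Euclidean.
Context {R : realType} {n : nat}.
Implicit Types (x y : 'rV[R]_n) (X : set 'rV[R]_n).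

Definition inner x y : R := \sum_(i < n) x ord0 i * y ord0 i.

Definition enorm x : R := Num.sqrt (inner x x).

Definition edistance x X : R := inf [set enorm (x - y) | y in X].

End Euclidean.

Section Calculus.
Context {R : realType} {n : nat}.
Implicit Type F : 'rV[R]_n -> R.

Definition grad F (x : 'rV[R]_n) : 'rV[R]_n :=
  \row_(i < n) 'D_(delta_mx ord0 i) F x.

(* The library Jacobian acts on row vectors on the right: v *m 'J f x is the
   differential of f at x applied to v.  Hence (hessian F x) i j is the
   derivative along e_i of the j-th partial derivative of F, and H_F(x) v is
   written v *m hessian F x. *)
Definition hessian F (x : 'rV[R]_n) : 'M[R]_n := 'J (grad F) x.

Definition C2 F : Prop :=
  [/\ forall x, differentiable F x,
      forall x, differentiable (grad F) x
    & continuous (hessian F)].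

Definition convex F : Prop :=
  convex_function (setT : set (convex_lmodType 'rV[R]_n)) F.

Definition argmin F : set 'rV[R]_n := [set x | forall y, F x <= F y].

(* The minimum of F whenever argmin F is nonempty. *)
Definition minval F : R := inf (range F).

(* G_mu^gamma *)
Definition growth F (mu gamma : R) : Prop :=
  forall x, mu / 2 * edistance x (argmin F) `^ gamma <= F x - minval F.

(* H_gamma *)
Definition flatness F (gamma : R) : Prop :=
  forall xs, argmin F xs ->
  forall x, F x - minval F <= gamma^-1 * inner (grad F x) (x - xs).

(* f has derivative l at t relative to the domain D; for D = [t0, +oo[ this is
   the usual derivative at t > t0 and the right derivative at t = t0. *)
Definition is_derive_within (D : set R) (f : R -> 'rV[R]_n) (t : R)
    (l : 'rV[R]_n) : Prop :=
  (s - t)^-1 *: (f s - f t) @[s --> within D t^'] --> l.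

(* v and a are the velocity and the acceleration of x; the values of x on
   ]-oo, t0[ are irrelevant. *)
Definition DIN_AVD_solution F (alpha beta t0 : R) (x : R -> 'rV[R]_n) : Prop :=
  exists v a : R -> 'rV[R]_n,
    [/\ forall t, t0 <= t -> is_derive_within `[t0, +oo[ x t (v t),
        forall t, t0 <= t -> is_derive_within `[t0, +oo[ v t (a t),
        v t0 = 0
      & forall t, t0 <= t ->
          a t + (alpha / t) *: v t + beta *: (v t *m hessian F (x t))
            + grad F (x t) = 0].

End Calculus.

(* Main.v *)
(* Put L = 2 / (gamma1 - 2), z = x - xstar, w = x' + beta grad F(x),
   s = t - beta (alpha - L), xi = L (L + 1 - alpha) < 0 and
     E(t) = t s (F(x) - F(xstar)) + |L z + t w|^2 / 2 + xi / 2 |z|^2.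
   With w, the Hessian disappears from the dynamics:
   w' = - (alpha / t) x' - grad F(x).  H_gamma1 gives, for large t,
     t E' + 2 L E <= beta c t (F(x) - F(xstar)) - beta t^2 s |grad F(x)|^2
   for some c >= 0.  The negative term of E is absorbed by G_mu^gamma2 up to a
   constant, because gamma2 <= gamma1: for a suitable C,
     W = t^(2 L) E + C >= t^(2 L + 2) (F(x) - F(xstar)) / 4.
   Hence the first error term is at most 4 beta c t^(-2) W once multiplied by
   t^(2 L - 1), and the integrating factor exp (4 beta c / t) makes
     P = W exp (4 beta c / t)
   a nonnegative Lyapunov function with
     P' <= - (beta / 2) t^(2 L + 2) |grad F(x)|^2.
   Both claims follow, since 2 L + 2 = 2 gamma1 / (gamma1 - 2). *)
Require Import Defs.
From mathcomp Require Import all_boot all_order all_algebra.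
From mathcomp Require Import all_classical all_reals all_analysis.
From mathcomp Require Import ring lra.
Import Order.TTheory GRing.Theory Num.Theory.
Import numFieldNormedType.Exports.

Set Implicit Arguments.
Unset Strict Implicit.
Unset Printing Implicit Defensive.

Local Open Scope classical_set_scope.
Local Open Scope ring_scope.

(** * Bilinearity and positivity of the Euclidean inner product *)

Section InnerProduct.
Context {R : realType} {n : nat}.
Implicit Types (x y z : 'rV[R]_n) (k : R).

Lemma innerC x y : inner x y = inner y x.
Proof. by apply: eq_bigr => i _; rewrite mulrC. Qed.

Lemma innerDl x y z : inner (x + y) z = inner x z + inner y z.
Proof. by rewrite -big_split; apply: eq_bigr => i _; rewrite mxE mulrDl. Qed.

Lemma innerZl k x y : inner (k *: x) y = k * inner x y.
Proof. by rewrite mulr_sumr; apply: eq_bigr => i _; rewrite mxE mulrA. Qed.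

Lemma innerDr x y z : inner x (y + z) = inner x y + inner x z.
Proof. by rewrite innerC innerDl !(innerC x). Qed.

Lemma innerZr k x y : inner x (k *: y) = k * inner x y.
Proof. by rewrite innerC innerZl innerC. Qed.

Lemma innerNl x y : inner (- x) y = - inner x y.
Proof. by rewrite -scaleN1r innerZl mulN1r. Qed.

Lemma innerNr x y : inner x (- y) = - inner x y.
Proof. by rewrite innerC innerNl innerC. Qed.

Lemma inner_ge0 x : 0 <= inner x x.
Proof. by apply: sumr_ge0 => i _; rewrite -expr2 sqr_ge0. Qed.

Lemma inner_lincomb_ge0 k l x y :
  0 <= k ^+ 2 * inner x x + 2 * k * l * inner x y + l ^+ 2 * inner y y.
Proof.
have := inner_ge0 (k *: x + l *: y).
rewrite !(innerDl, innerDr, innerZl, innerZr) (innerC y x).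
by congr (_ <= _); ring.
Qed.

Lemma enorm_ge0 x : 0 <= enorm x.
Proof. exact: sqrtr_ge0. Qed.

Lemma enorm_sqr x : enorm x ^+ 2 = inner x x.
Proof. by rewrite sqr_sqrtr// inner_ge0. Qed.

Lemma edistance1 x y : edistance x [set y] = enorm (x - y).
Proof. by rewrite /edistance image_set1 inf1. Qed.

End InnerProduct.

(** * Minimum value, one-sided derivatives, chain rules *)

Section Calculus.
Context {R : realType} {n : nat}.
Implicit Types (F : 'rV[R]_n -> R) (f g : R -> 'rV[R]_n) (t : R).

Lemma minvalE F x : argmin F x -> minval F = F x.
Proof.
move=> xmin; apply/eqP; rewrite eq_le; apply/andP; split.
  by apply: ge_inf; [exists (F x) => _ [y _ <-]; exact: xmin|exists x].
by apply: lb_le_inf => [|_ [y _ <-]]; [exists (F x), x|exact: xmin].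
Qed.

(** Near an interior point the restriction to [D] is void, and the substitution s = h + t recovers
    the usual difference quotient. *)
Lemma is_derive_within_interior (D : set R) f t l :
  interior D t -> is_derive_within D f t l -> is_derive t 1 f l.
Proof.
move=> Dt fl.
have {}fl : h^-1 *: (f (h *: (1 : R) + t) - f t) @[h --> 0^'] --> l.
  have shiftP (P : set R) :
      (\forall s \near t, P s) -> \forall h \near (0 : R), P (h + t).
    rewrite (near_shift (0 : R^o) (t : R^o) P).
    by apply: filterS => h /=; rewrite subr0.
  apply/cvgrPdist_lt => e e0.
  move/cvgrPdist_lt : fl => /(_ _ e0).
  rewrite !near_withinE => /shiftP; apply: filterS2 (shiftP _ Dt) => h /= Dh.
  by rewrite addrK [h *: 1]mulr1 => + h0; apply=> //; rewrite -subr_eq0 addrK.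
split; last exact: cvg_lim fl.
by apply/cvg_ex; exists l.
Unshelve. all: by end_near. Qed.

(** Write f s as (s - t) times the difference quotient, plus f t. This gives continuity up to [t0],
    where only a one-sided derivative exists. *)
Lemma is_derive_within_continuous (D : set R) f (df : R -> 'rV[R]_n) :
  (forall t, D t -> is_derive_within D f t (df t)) -> {within D, continuous f}.
Proof.
move=> Df; apply/subspace_continuousP => t Dt.
have cf : f s @[s --> within D t^'] --> f t.
  have lim0 : (s - t) *: ((s - t)^-1 *: (f s - f t)) @[s --> within D t^']
      --> (0 : R) *: df t.
    apply: cvgZ (Df _ Dt); rewrite -(subrr t).
    have sub : s - t @[s --> t] --> t - t by exact: (cvgB cvg_id (cvg_cst t)).
    apply: cvg_trans sub; apply: cvg_app.
    apply: cvg_trans (@nbhs_dnbhs _ t). exact: cvg_within.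
  have lim1 : (s - t) *: ((s - t)^-1 *: (f s - f t)) + f t
      @[s --> within D t^'] --> (0 : R) *: df t + f t.
    exact: (cvgD lim0 (cvg_cst _)).
  rewrite scale0r add0r in lim1.
  apply: cvg_trans lim1; apply: near_eq_cvg; rewrite !near_withinE.
  apply: nearW => s st _ /=.
  by rewrite scalerA mulfV ?subr_eq0// scale1r subrK.
apply/cvgrPdist_lt => e e0.
move/cvgrPdist_lt : cf => /(_ _ e0); rewrite !near_withinE.
apply: filterS => s /= fs Ds.
by have [->|/fs/(_ Ds)//] := eqVneq s t; rewrite subrr normr0.
Qed.

Lemma is_derive_coord f t (df : 'rV_n) (i : 'I_n) :
  is_derive t 1 f df -> is_derive t 1 (fun s => f s ord0 i) (df ord0 i).
Proof.
move=> [fd <-]; split; first exact: (derivable_mxP f t 1).1.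
by rewrite derive_mx// mxE.
Qed.

Lemma is_derive_inner f g t (df dg : 'rV[R]_n) :
  is_derive t 1 f df -> is_derive t 1 g dg ->
  is_derive t 1 (fun s => inner (f s) (g s)) (inner df (g t) + inner (f t) dg).
Proof.
move=> fdf gdg; rewrite /inner -big_split /=.
rewrite (_ : (fun s => _) =
  \sum_(i < n) (fun s => f s ord0 i) * (fun s => g s ord0 i)); last first.
  by apply/funext => s; rewrite fct_sumE.
apply: is_derive_sum => i.
apply: is_derive_eq (is_deriveM (is_derive_coord i fdf)
  (is_derive_coord i gdg)) _.
by rewrite addrC -[g t _ _ *: _]mulrC.
Qed.

Lemma inner_grad F x (v : 'rV[R]_n) :
  differentiable F x -> 'd F x v = inner (grad F x) v.
Proof.
move=> dF; rewrite [in LHS](row_sum_delta v) linear_sum.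
apply: eq_bigr => i _; rewrite linearZ mxE /= deriveE//.
exact: mulrC.
Qed.

Lemma is_derive_comp_diff (V : normedModType R) (G : 'rV[R]_n -> V) f t df :
  differentiable G (f t) -> is_derive t 1 f df ->
  is_derive t 1 (G \o f) ('d G (f t) df).
Proof.
move=> dG [/derivable1_diffP df1 fdf].
split; first exact/derivable1_diffP/differentiable_comp.
rewrite deriveE; last exact: differentiable_comp.
by rewrite diff_comp//= -fdf deriveE.
Qed.

End Calculus.

(** * Scalar inequalities behind the energy estimate *)

Section EnergyEstimates.
Context {R : realType}.
Implicit Types (r t : R).

(* zz, zw, ww, Gz, Gw, GG are the inner products of z, w and G = grad F(x);
   zv, vw, zdw, wdw are those with v = x' = w - beta G and dw = w'. *)
Lemma energy_dissipation (L alpha beta gamma t phi zz zw ww Gz Gw GG : R) :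
  0 < L -> 0 < t -> L * gamma = 2 + 2 * L -> 2 * L + 1 <= alpha ->
  beta * (2 * alpha - 2 * L - 1) <= t -> gamma * phi <= Gz ->
  0 <= L ^+ 2 * zz + 2 * L * t * zw + t ^+ 2 * ww ->
  let s := t - beta * (alpha - L) in
  let xi := L * (L + 1 - alpha) in
  let zv := zw - beta * Gz in
  let vw := ww - beta * Gw in
  let zdw := - (alpha / t) * zv - Gz in
  let wdw := - (alpha / t) * vw - Gw in
  t * ((s + t) * phi + t * s * (Gw - beta * GG) + (L ^+ 2 + xi) * zv
       + (L * zw + L * t * (vw + zdw)) + (t * ww + t ^+ 2 * wdw))
  + 2 * L * (t * s * phi + (L ^+ 2 * zz + 2 * L * t * zw + t ^+ 2 * ww) / 2
             + xi / 2 * zz)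
  <= beta * ((alpha - L) * (3 + 2 * L) - 2 - 2 * L) * t * phi
     - beta * t ^+ 2 * s * GG.
Proof.
move=> L0 t0 Lg aL tb gG U0 /=; rewrite -subr_ge0.
set U := _ + _ in U0.
(* The gap between the two sides is exactly a sum of two nonnegative products: the excess of [alpha]
   times [U], and the slack in flatness times a factor that is nonnegative for large [t]. *)
rewrite [leRHS](_ : _ = (alpha - 2 * L - 1) * U +
  L * t * (t - beta * (2 * alpha - 2 * L - 1)) * (Gz - gamma * phi));
  last first.
  have -> : gamma = (2 + 2 * L) / L by rewrite -Lg mulrAC mulfV ?mul1r ?gt_eqF.
  by rewrite /U; field; rewrite !gt_eqF.
apply: addr_ge0; apply: mulr_ge0 => //; try lra.
by rewrite mulr_ge0 ?subr_ge0// mulr_ge0 ?ltW.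
Qed.

Lemma powR_add2 t r : 0 < t -> t `^ (r + 2) = t `^ r * t ^+ 2.
Proof.
by move=> t0; rewrite powRD ?(gt_eqF t0) ?implybT// powR_mulrn ?ltW.
Qed.

(** A Young-type inequality whose additive constant is independent of [t] and [r]; it serves to
    absorb the negative term of the energy into the growth bound. *)
Lemma powR_young (L gamma eps t r : R) :
  2 < gamma -> L * (gamma - 2) <= 2 -> 0 < eps -> 1 <= t -> 0 <= r ->
  t `^ (2 * L) * r ^+ 2 <=
    eps * (t `^ (2 * L + 2) * r `^ gamma) + eps `^ (- (2 / (gamma - 2))).
Proof.
move=> g2 Lg eps0 t1; rewrite le_eqVlt => /predU1P[<-|r0].
  by rewrite expr0n mulr0 addr_ge0 ?mulr_ge0 ?powR_ge0 ?ltW.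
have t0 : 0 < t by exact: lt_le_trans t1.
have -> : r `^ gamma = r `^ (gamma - 2) * r ^+ 2.
  by rewrite -powR_add2// subrK.
rewrite powR_add2//.
(* If eps t^2 r^(gamma - 2) >= 1 the first term on the right dominates.
   Otherwise r^2 <= (eps t^2)^(- 2 / (gamma - 2)), and t ends up with the
   exponent 2 L - 4 / (gamma - 2) <= 0. *)
have [le1|/ltW ge1] := leP 1 (eps * t ^+ 2 * r `^ (gamma - 2)).
  rewrite ler_wpDr ?powR_ge0//.
  have := ler_wpM2l (mulr_ge0 (powR_ge0 t (2 * L)) (sqr_ge0 r)) le1.
  by rewrite mulr1 => /le_trans; apply; rewrite le_eqVlt; apply/orP; left;
    apply/eqP; ring.
have [t_ge0 r_ge0] := (ltW t0, ltW r0).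
rewrite ler_wpDl ?mulr_ge0 ?powR_ge0 ?sqr_ge0 ?(ltW eps0)//.
have g0 : gamma - 2 != 0 by rewrite gt_eqF// subr_gt0.
have q0 : 0 <= 2 / (gamma - 2) by rewrite divr_ge0// subr_ge0 ltW.
set p := 2 / (gamma - 2) in q0 *.
have {}ge1 : (eps * t ^+ 2 * r `^ (gamma - 2)) `^ p <= 1.
  rewrite [leRHS](_ : 1 = 1 `^ p); last by rewrite powR1.
  apply: ge0_ler_powR => //; rewrite nnegrE//.
  by rewrite !mulr_ge0 ?powR_ge0 ?sqr_ge0 ?ltW.
have {}ge1 : eps `^ p * (t `^ (2 * p) * r ^+ 2) <= 1.
  apply: le_trans ge1; rewrite mulrA le_eqVlt; apply/orP; left; apply/eqP.
  rewrite (@powRM _ (eps * t ^+ 2)) ?(@powRM _ eps) ?mulr_ge0 ?powR_ge0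
    ?sqr_ge0 ?(ltW eps0)//.
  rewrite -(@powRrM _ _ (gamma - 2)) [(gamma - 2) * _]mulrC divfK//.
  by rewrite -(powR_mulrn 2 (ltW t0)) -powRrM -(powR_mulrn 2 (ltW r0)).
rewrite powRN -[leRHS]mul1r ler_pdivlMr ?powR_gt0// mulrC.
(* The hypothesis on [L] says L <= p, so t^(2 L) <= t^(2 p) because t >= 1. *)
apply: le_trans ge1; rewrite ler_wpM2l ?powR_ge0// ler_wpM2r ?sqr_ge0//.
by rewrite ler_powR// ler_pM2l// ler_pdivlMr ?subr_gt0.
Qed.

End EnergyEstimates.

(** * The energy, its derivative and the Lyapunov bounds *)

Section LyapunovFunction.
Context {R : realType}.
Implicit Types (r t : R).

(** The middle term is |L z + t w|^2 / 2, expanded to match the scalar variables of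
    [energy_dissipation]. *)
Definition energy n (L b xi : R) (phi : R -> R) (z w : R -> 'rV[R]_n) t : R :=
  t * (t - b) * phi t
  + (L ^+ 2 * inner (z t) (z t) + 2 * L * t * inner (z t) (w t)
     + t ^+ 2 * inner (w t) (w t)) / 2
  + xi / 2 * inner (z t) (z t).

(** The terms are grouped as in the first factor of [energy_dissipation]. *)
Lemma is_derive_energy n L b xi (phi : R -> R) (z w : R -> 'rV[R]_n) t
    (dphi : R) (dz dw : 'rV[R]_n) :
  is_derive t 1 phi dphi -> is_derive t 1 z dz -> is_derive t 1 w dw ->
  is_derive t 1 (energy L b xi phi z w)
    ((t - b + t) * phi t + t * (t - b) * dphi
     + (L ^+ 2 + xi) * inner (z t) dz
     + (L * inner (z t) (w t)
        + L * t * (inner dz (w t) + inner (z t) dw))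
     + (t * inner (w t) (w t) + t ^+ 2 * inner (w t) dw)).
Proof.
move=> Dphi Dz Dw.
have Dzz := is_derive_inner Dz Dz.
have Dzw := is_derive_inner Dz Dw.
have Dww := is_derive_inner Dw Dw.
have Did := is_derive_id t (1 : R).
have Dquad := is_deriveD (is_deriveD (is_deriveZ (L ^+ 2) Dzz)
  (is_deriveM (is_deriveM (is_derive_cst (2 * L) t 1) Did) Dzw))
  (is_deriveM (is_deriveM Did Did) Dww).
have Dpot := is_deriveM
  (is_deriveM Did (is_deriveB Did (is_derive_cst b t 1))) Dphi.
have D := is_deriveD (is_deriveD Dpot (is_deriveZ 2^-1 Dquad))
  (is_deriveZ (xi / 2) Dzz).
rewrite (_ : energy L b xi phi z w = fun s => s * (s - b) * phi s
  + 2^-1 * (L ^+ 2 * inner (z s) (z s) + 2 * L * s * inner (z s) (w s)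
            + s * s * inner (w s) (w s)) + xi / 2 * inner (z s) (z s));
  last first.
  by apply/funext => s; rewrite /energy ![_ / 2]mulrC expr2.
apply: is_derive_eq D _.
rewrite (innerC dz (z t)) (innerC dw (w t)) !fctE /GRing.scale /=.
by field.
Qed.

(** Pulling out t^L / t leaves t E' + L E, the quantity bounded by [energy_dissipation]; the last
    term comes from the integrating factor. *)
Lemma is_derive_lyapunov (L K C : R) (E : R -> R) t dE :
  0 < t -> is_derive t 1 E dE ->
  is_derive t 1 (fun s => (s `^ L * E s + C) * expR (K / s))
    (expR (K / t) * (t `^ L / t * (t * dE + L * E t)
                     - K / t ^+ 2 * (t `^ L * E t + C))).
Proof.
move=> t0 DE.
have Dpow := is_derive1_powR L t0.
have Dinv : is_derive t 1 (fun s => K * s^-1) (- (K / t ^+ 2)).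
  have Di := is_deriveV (lt0r_neq0 t0) (is_derive_id t 1).
  have := is_deriveM (is_derive_cst K t 1) Di.
  move=> /is_derive_eq; apply.
  rewrite /GRing.scale /=; ring.
have Dexp := is_derive1_comp (is_derive_expR _) Dinv.
rewrite (_ : (fun s => _) =
  ((fun s => s `^ L) * E + cst C) * (expR \o (fun s => K * s^-1))) //.
apply: is_derive_eq.
rewrite /= powRB ?(gt_eqF t0) ?implybT// powRr1 ?ltW//.
rewrite !fctE /GRing.scale /=.
by field; rewrite gt_eqF.
Qed.

(** By the lower bound on [W], the term with factor 4 beta c compensates the [phi] term of [D].
    Since s >= t / 2, half of the gradient term survives, and e >= 1 only makes a nonpositive
    quantity smaller. *)
Lemma lyapunov_dissipation (L beta c t s phi GG W D e : R) :
  0 < t -> 0 <= beta -> 0 <= c -> t <= 2 * s -> 0 <= GG -> 1 <= e ->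
  t `^ L * t ^+ 2 * phi / 4 <= W ->
  D <= beta * c * t * phi - beta * t ^+ 2 * s * GG ->
  e * (t `^ L / t * D - (4 * (beta * c)) / t ^+ 2 * W)
    <= - (beta / 2 * (t `^ L * t ^+ 2 * GG)).
Proof.
move=> t0 beta0 c0 ts GG0 e1 hW hD.
have tL0 : 0 <= t `^ L by exact: powR_ge0.
have h : t `^ L / t * D - 4 * (beta * c) / t ^+ 2 * W
    <= - (beta / 2 * (t `^ L * t ^+ 2 * GG)).
  have hD' := ler_wpM2l (divr_ge0 tL0 (ltW t0)) hD.
  have hW' : 4 * (beta * c) / t ^+ 2 * (t `^ L * t ^+ 2 * phi / 4)
      <= 4 * (beta * c) / t ^+ 2 * W.
    by rewrite ler_wpM2l// divr_ge0 ?sqr_ge0// mulr_ge0// mulr_ge0.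
  have ht : beta * (t `^ L * t * GG) * (t / 2) <= beta * (t `^ L * t * GG) * s.
    by rewrite ler_wpM2l ?mulr_ge0 ?(ltW t0)//; lra.
  have e2 : 4 * (beta * c) / t ^+ 2 * (t `^ L * t ^+ 2 * phi / 4)
      = beta * c * t `^ L * phi by field; rewrite gt_eqF.
  have e3 : t `^ L / t * (beta * c * t * phi - beta * t ^+ 2 * s * GG) =
      beta * c * t `^ L * phi - beta * (t `^ L * t * GG) * s.
    by field; rewrite gt_eqF.
  rewrite e2 in hW'; rewrite e3 in hD'.
  have -> : beta / 2 * (t `^ L * t ^+ 2 * GG) =
    beta * (t `^ L * t * GG) * (t / 2) by field.
  lra.
apply: (le_trans _ h); rewrite -[leRHS]mul1r ler_wnM2r//.
apply: le_trans h _.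
by rewrite oppr_le0; repeat apply: mulr_ge0; rewrite ?invr_ge0// ltW.
Qed.

Lemma lyapunov_lower_bound (L mu gamma xi t s r phi U : R) :
  0 < mu -> 2 < gamma -> L * (gamma - 2) <= 2 -> xi < 0 ->
  1 <= t -> t <= 2 * s -> 0 <= r -> 0 <= phi -> 0 <= U ->
  mu / 2 * r `^ gamma <= phi ->
  t `^ (2 * L) * t ^+ 2 * phi / 4 <=
  t `^ (2 * L) * (t * s * phi + U / 2 + xi / 2 * r ^+ 2)
  + - xi / 2 * (mu / (4 * - xi)) `^ (- (2 / (gamma - 2))).
Proof.
move=> mu0 g2 Lg xi0 t1 ts r0 phi0 U0 gr.
have xiN0 : 0 < - xi by rewrite oppr_gt0.
have t0 : 0 <= t by exact: le_trans t1.
(* With this Young parameter the [xi] term costs at most a quarter of t^(2 L + 2) phi, up to a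
   constant; [h1] provides a half, so a quarter remains. *)
have eps0 : 0 < mu / (4 * - xi) by rewrite divr_gt0// mulr_gt0.
have Y := powR_young g2 Lg eps0 t1 r0.
rewrite powR_add2 ?(lt_le_trans ltr01)// in Y.
set K := _ `^ (- _) in Y *.
set q := t `^ (2 * L) in Y *.
have q0 : 0 <= q by exact: powR_ge0.
have h1 : q * t ^+ 2 * phi / 2 <= q * (t * s * phi).
  rewrite [leLHS](_ : _ = q * t * phi * (t / 2)); last by field.
  rewrite [leRHS](_ : _ = q * t * phi * s); last by ring.
  by rewrite ler_wpM2l ?mulr_ge0//; lra.
have h2 := ler_wpM2l (mulr_ge0 q0 (sqr_ge0 t)) gr.
have h3 := ler_wpM2l (ltW xiN0) Y.
have e2 : - xi * (mu / (4 * - xi) * (q * t ^+ 2 * r `^ gamma) + K) =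
  q * t ^+ 2 * (mu / 2 * r `^ gamma) / 2 + - xi * K.
  by field; rewrite lt_eqF.
rewrite e2 in h3.
have h4 : 0 <= q * U by exact: mulr_ge0.
lra.
Qed.

End LyapunovFunction.

(** * From dissipation to integrability *)

Section DissipationIntegral.
Context {R : realType}.
Notation mu := (@lebesgue_measure R).

Lemma nonincreasing_of_derive (P : R -> R) (T : R) :
  (forall t, T <= t -> exists2 dP, is_derive t 1 P dP & dP <= 0) ->
  forall s t, T <= s -> s <= t -> P t <= P s.
Proof.
move=> DP; apply: ler0_derive1_nincry.
- move=> t; rewrite in_itv/= andbT => /ltW /DP[dP ? _].
  exact: ex_derive.
- move=> t; rewrite in_itv/= andbT => /ltW /DP[dP ? ?].
  by rewrite derive1E derive_val.
- apply: continuous_in_subspaceT => t; rewrite inE/= in_itv/= andbT.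
  move=> /DP[dP ? _]; apply: differentiable_continuous.
  by apply/derivable1_diffP; exact: ex_derive.
Qed.

(** With Q the integral of [g] from [t0], P + c Q is nonincreasing beyond [T] and P >= 0, so Q is
    bounded; monotone convergence concludes. *)
Lemma dissipation_integral (P g : R -> R) (t0 T c : R) :
  t0 < T -> 0 < c -> {within `[t0, +oo[, continuous g} ->
  (forall t, 0 <= g t) ->
  (forall t, T <= t -> 0 <= P t) ->
  (forall t, T <= t -> exists2 dP, is_derive t 1 P dP & dP <= - (c * g t)) ->
  (\int[mu]_(u in `[t0, +oo[) (g u)%:E < +oo)%E.
Proof.
move=> t0T c0 gcont g0 P0 DP.
have gint t : mu.-integrable `[t0, t] (EFin \o g).
  apply: continuous_compact_integrable; first exact: segment_compact.
  by apply: continuous_subspaceW gcont; exact: subset_itvl.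
pose Q t := \int[mu]_(u in `[t0, t]) g u.
have DQ t : T <= t -> is_derive t 1 Q (g t).
  move=> Tt; have t0t := lt_le_trans t0T Tt.
  have gt : {for t, continuous g}.
    move/continuous_within_itvcyP : gcont => [gcont _].
    by apply: gcont; rewrite in_itv/= andbT.
  (* The endpoint t + 1 merely makes [t] interior to the interval of integration, so that the
     derivative is two-sided. *)
  have tt1 : t < t + 1 by rewrite ltrDl.
  have [Qt Q't] := continuous_FTC1_closed tt1 (gint _) t0t gt.
  by split; [exact: Qt|rewrite -derive1E; exact: Q't].
have PQ : forall s t, T <= s -> s <= t ->
    (P + cst c * Q) t <= (P + cst c * Q) s.
  apply: nonincreasing_of_derive => t Tt; have [dP DPt dPle] := DP _ Tt.
  have DQt := DQ _ Tt.
  eexists; first exact: is_deriveD.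
  rewrite /GRing.scale /= mulr0 addr0; lra.
pose M := Q T + P T / c.
have QM t : T <= t -> Q t <= M.
  move=> Tt; have := PQ T t (lexx _) Tt; rewrite !fctE /= => h.
  have Pt := P0 _ Tt.
  rewrite -(ler_pM2l c0) mulrDr mulrCA divff ?gt_eqF// mulr1; lra.
apply: (@le_lt_trans _ _ M%:E); last exact: ltry.
(* The half-line is the increasing union of the segments [t0, t0 + i]; [QM] applies once t0 + i >=
   T. *)
rewrite itv_bndy_bigcup_BRight.
have icvg :
    (\int[mu]_(u in `[t0, (t0 + i%:R)%R]%classic) (g u)%:E)%E @[i --> \oo] -->
    (\int[mu]_(u in \bigcup_i `[t0, (t0 + i%:R)%R]%classic) (g u)%:E)%E.
  apply: ge0_nondecreasing_set_cvg_integral => //.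
  - move=> i j ij; apply/subsetPset; apply: subset_itvl.
    by rewrite bnd_simp lerD2l ler_nat.
  - by move=> i; case/integrableP : (gint (t0 + i%:R)).
  - by move=> i u _; rewrite lee_fin.
rewrite -(cvg_lim _ icvg)//; apply: lime_le.
  by apply/cvg_ex; eexists; exact: icvg.
near=> i.
have -> : (\int[mu]_(u in `[t0, (t0 + i%:R)%R]%classic) (g u)%:E)%E =
    (Q (t0 + i%:R))%:E.
  by rewrite /Q /Rintegral fineK//; exact: integrable_fin_num.
rewrite lee_fin QM// -lerBlDl.
near: i; exact: nbhs_infty_ger.
Unshelve. all: by end_near. Qed.

End DissipationIntegral.

(** * Assembly along a trajectory *)

Theorem theorem3 (R : realType) (n : nat) (F : 'rV[R]_n -> R)
  (xstar : 'rV[R]_n) (gamma1 gamma2 mu alpha beta t0 : R) (x : R -> 'rV[R]_n)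
  (F_convex : convex F) (F_C2 : C2 F)
  (xstar_unique : argmin F = [set xstar])
  (gamma1_gt2 : 2 < gamma1) (gamma2_gt2 : 2 < gamma2)
  (gamma2_le : gamma2 <= gamma1) (mu_gt0 : 0 < mu)
  (F_flat : flatness F gamma1) (F_growth : growth F mu gamma2)
  (t0_gt0 : 0 < t0) (alpha_ge : (gamma1 + 2) / (gamma1 - 2) <= alpha)
  (beta_gt0 : 0 < beta)
  (x_sol : DIN_AVD_solution F alpha beta t0 x) :
  (fun t => F (x t) - F xstar : R^o) =O_ (+oo_R)
    (fun t => t `^ (- (2 * gamma1 / (gamma1 - 2))) : R^o)
  /\ (\int[lebesgue_measure]_(u in `[t0, +oo[)
        (u `^ (2 * gamma1 / (gamma1 - 2)) * enorm (grad F (x u)) ^+ 2)%:E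
      < +oo)%E.
Proof.
have [v [a [Dx Dv _ ode]]] := x_sol.
have [dF dG _] := F_C2.
pose L := 2 / (gamma1 - 2).
have g1 : 0 < gamma1 - 2 by rewrite subr_gt0.
have L0 : 0 < L by rewrite divr_gt0.
(* This identity cancels the t^2 phi terms in the energy estimate. *)
have Lg : L * gamma1 = 2 + 2 * L by rewrite /L; field; rewrite gt_eqF.
have Lg2 : L * (gamma2 - 2) <= 2.
  by rewrite /L mulrAC ler_pdivrMr// ler_pM2l// lerD2r.
have aL : 2 * L + 1 <= alpha.
  apply: le_trans alpha_ge; rewrite le_eqVlt; apply/orP; left; apply/eqP.
  by rewrite /L; field; rewrite gt_eqF.
have -> : 2 * gamma1 / (gamma1 - 2) = 2 * L + 2.
  by rewrite /L; field; rewrite gt_eqF.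
have xmin : argmin F xstar by rewrite xstar_unique.
have Fmin : minval F = F xstar := minvalE xmin.
pose phi t := F (x t) - F xstar.
have phi0 t : 0 <= phi t by rewrite subr_ge0; exact: xmin.
pose z t := x t - xstar.
pose G t := grad F (x t).
pose w t := v t + beta *: G t.
have flat t : gamma1 * phi t <= inner (G t) (z t).
  have := F_flat _ xmin (x t); rewrite Fmin ler_pdivlMl//.
  exact: lt_trans gamma1_gt2.
have grow t : mu / 2 * enorm (z t) `^ gamma2 <= phi t.
  by have := F_growth (x t); rewrite xstar_unique edistance1 Fmin.
pose b := beta * (alpha - L).
pose xi := L * (L + 1 - alpha).
have xi0 : xi < 0 by rewrite pmulr_rlt0//; lra.
pose c := (alpha - L) * (3 + 2 * L) - 2 - 2 * L.
(* Since alpha - L >= L + 1, [c] is at least (L + 1) (2 L + 1). *)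
have c0 : 0 <= c by rewrite /c; nra.
have b0 : 0 <= b by rewrite mulr_ge0 ?(ltW beta_gt0)//; lra.
have b'0 : 0 <= beta * (2 * alpha - 2 * L - 1).
  by rewrite mulr_ge0 ?(ltW beta_gt0)//; lra.
(* The summands ensure, in turn, t >= 1, t > t0, t <= 2 (t - b) and the threshold of
   [energy_dissipation]. *)
pose T := 1 + t0 + 2 * b + beta * (2 * alpha - 2 * L - 1).
have t0T : t0 < T by rewrite /T; lra.
have T1 t : T <= t -> 1 <= t by rewrite /T; lra.
have Tb t : T <= t -> t <= 2 * (t - b) by rewrite /T; lra.
have Tb' t : T <= t -> beta * (2 * alpha - 2 * L - 1) <= t by rewrite /T; lra.
have int_t0 t : t0 < t -> interior `[t0, +oo[%classic t.
  by move=> t0t; rewrite interior_itv_bndy /= in_itv/= t0t.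
have dx t : t0 < t -> is_derive t 1 x (v t).
  move=> t0t; apply: (is_derive_within_interior (int_t0 _ t0t)).
  exact/Dx/ltW.
have dv t : t0 < t -> is_derive t 1 v (a t).
  move=> t0t; apply: (is_derive_within_interior (int_t0 _ t0t)).
  exact/Dv/ltW.
have dz t : t0 < t -> is_derive t 1 z (v t).
  move=> /dx dxt.
  apply: is_derive_eq (is_deriveB dxt (is_derive_cst xstar t 1)) _.
  exact: subr0.
have dphi t : t0 < t -> is_derive t 1 phi (inner (G t) (v t)).
  move=> /dx dxt; have := is_derive_comp_diff (dF (x t)) dxt.
  rewrite inner_grad// => dFx.
  apply: is_derive_eq (is_deriveB dFx (is_derive_cst (F xstar) t 1)) _.
  exact: subr0.
have dw t : t0 < t -> is_derive t 1 w (- (alpha / t) *: v t - G t).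
  move=> t0t; have := is_derive_comp_diff (dG (x t)) (dx _ t0t).
  rewrite -deriveE// deriveEjacobian// => dGx.
  apply: is_derive_eq (is_deriveD (dv _ t0t) (is_deriveZ beta dGx)) _.
  (* Substituting the equation for [a t] cancels the Hessian term that comes from differentiating
     [beta *: G t]. *)
  have -> : a t = - ((alpha / t) *: v t + beta *: (v t *m hessian F (x t))
      + grad F (x t)).
    by apply/eqP; rewrite -addr_eq0 !addrA; exact/eqP/ode/ltW.
  by rewrite !opprD addrAC subrK scaleNr.
pose E := energy L b xi phi z w.
pose C := - xi / 2 * (mu / (4 * - xi)) `^ (- (2 / (gamma2 - 2))).
pose W t := t `^ (2 * L) * E t + C.
pose K := 4 * (beta * c).
have K0 : 0 <= K by rewrite !mulr_ge0// ltW.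
pose P t := W t * expR (K / t).
have U0 t : 0 <= L ^+ 2 * inner (z t) (z t) + 2 * L * t * inner (z t) (w t)
     + t ^+ 2 * inner (w t) (w t).
  exact: inner_lincomb_ge0.
have W_ge t : T <= t -> t `^ (2 * L) * t ^+ 2 * phi t / 4 <= W t.
  move=> Tt; rewrite /W /E /energy -(enorm_sqr (z t)).
  apply: lyapunov_lower_bound => //; rewrite ?enorm_sqr ?T1 ?Tb//.
  exact: enorm_ge0.
have W0 t : T <= t -> 0 <= W t.
  move=> Tt; apply: le_trans (W_ge _ Tt).
  by rewrite divr_ge0// mulr_ge0// mulr_ge0 ?powR_ge0 ?sqr_ge0.
have exp_ge1 t : T <= t -> 1 <= expR (K / t).
  move=> Tt; rewrite -expR0 ler_expR divr_ge0//.
  exact: le_trans (T1 _ Tt).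
have P_ge0 t : T <= t -> 0 <= P t.
  by move=> Tt; rewrite mulr_ge0 ?W0 ?expR_ge0.
pose g t := t `^ (2 * L + 2) * enorm (grad F (x t)) ^+ 2.
have g0 t : 0 <= g t by rewrite mulr_ge0 ?powR_ge0 ?sqr_ge0.
have DP t : T <= t ->
    exists2 dP, is_derive t 1 P dP & dP <= - (beta / 2 * g t).
  move=> Tt; have t0t := lt_le_trans t0T Tt.
  have t_gt0 := lt_trans t0_gt0 t0t.
  have dE := is_derive_energy L b xi (dphi _ t0t) (dz _ t0t) (dw _ t0t).
  eexists; first exact: (is_derive_lyapunov (2 * L) K C t_gt0 dE).
  rewrite /g powR_add2// enorm_sqr.
  apply: (lyapunov_dissipation t_gt0 (ltW beta_gt0) c0 (Tb _ Tt)
    (inner_ge0 _) (exp_ge1 _ Tt) (W_ge _ Tt)).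
  apply: le_trans (energy_dissipation (inner (G t) (w t)) (inner (G t) (G t))
    L0 t_gt0 Lg aL (Tb' _ Tt) (flat t) (U0 t)).
  rewrite le_eqVlt; apply/orP; left; apply/eqP.
  (* Only an identity is left: [v] is eliminated so that all inner products involve z, w and G
     alone. *)
  have -> : v t = w t - beta *: G t by rewrite addrK.
  rewrite /E /energy; move: (w t) (z t) (G t) (phi t) => wt zt Gt phit.
  rewrite !(innerDl, innerDr, innerZl, innerZr, innerNl, innerNr).
  rewrite (innerC wt Gt) (innerC zt Gt) /b /xi.
  by field; rewrite gt_eqF.
have PT t : T <= t -> P t <= P T.
  move=> Tt; apply: (nonincreasing_of_derive _ (lexx T) Tt) => s Ts.
  have [dP ? dPle] := DP _ Ts; exists dP => //; apply: le_trans dPle _.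
  by rewrite oppr_le0 mulr_ge0// divr_ge0// ltW.
split.
  (* W <= P <= P T gives the constant 4 P T; the added 1 makes it positive, as only P T >= 0 is
     known. *)
  apply/eqO_exP; exists (4 * P T + 1).
    by rewrite ltr_wpDl// mulr_ge0 ?P_ge0.
  exists T; split; first exact: num_real.
  move=> t /ltW Tt /=.
  have t_gt0 := lt_le_trans ltr01 (T1 _ Tt).
  suff : `|phi t| <= (4 * P T + 1) * `|t `^ (- (2 * L + 2))| by [].
  rewrite !ger0_norm ?powR_ge0// powRN ler_pdivlMr ?powR_gt0//.
  rewrite powR_add2//.
  have := W_ge _ Tt; have := PT _ Tt.
  have : W t <= P t by rewrite ler_peMr ?W0 ?exp_ge1.
  lra.
apply: (@dissipation_integral _ P g t0 T (beta / 2)) => //.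
  by rewrite divr_gt0.
(* There remains the continuity of the integrand on the closed half-line, [t0] included, hence
   limits within it. *)
have xcont : {within `[t0, +oo[, continuous x}.
  apply: is_derive_within_continuous => t; rewrite /= in_itv/= andbT.
  exact: Dx.
apply/subspace_continuousP => t; rewrite /= in_itv/= andbT => t0t.
have t_gt0 := lt_le_trans t0_gt0 t0t.
have xt : x s @[s --> within `[t0, +oo[ (nbhs t)] --> x t.
  by move/subspace_continuousP : xcont; apply; rewrite /= in_itv/= andbT.
have Gt : G s @[s --> within `[t0, +oo[ (nbhs t)] --> G t.
  exact: (continuous_cvg (h := grad F) _
    (differentiable_continuous (dG (x t))) xt).
have pt : s `^ (2 * L + 2) @[s --> within `[t0, +oo[ (nbhs t)]
    --> t `^ (2 * L + 2).
  apply: cvg_within_filter.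
  suff : {for t, continuous (@powR R ^~ (2 * L + 2))} by [].
  apply/differentiable_continuous/derivable1_diffP/derivable_powR.
  by rewrite in_itv/= andbT.
have nt : enorm (G s) ^+ 2 @[s --> within `[t0, +oo[ (nbhs t)]
    --> enorm (G t) ^+ 2.
  rewrite enorm_sqr; under eq_cvg do rewrite enorm_sqr.
  apply: cvg_big => [|i _]; first exact: add_continuous.
  have Gi : G s ord0 i @[s --> within `[t0, +oo[ (nbhs t)] --> G t ord0 i.
    exact: (continuous_cvg (h := fun y : 'rV_n => y ord0 i) _
      (@coord_continuous _ _ _ ord0 i (G t)) Gt).
  exact: cvgM.
exact: cvgM.
Qed.
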